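(* Let $T\colon[0,1)\to[0,1)$ be an interval exchange transformation and let $\mu$ be a $T$-invariant, $T$-ergodic Borel probability measure on $[0,1)$. Then \[\liminf_{n\to\infty} n\,|T^n(x)-y|=0\quad\text{for } \mu\times\mu\text{-almost every }(x,y)\in[0,1)^2.\]
   Context: An interval exchange transformation (IET) is given by an integer $r\ge2$, a permutation $\pi$ of $\{1,\dots,r\}$ and a vector $(\ell_1,\dots,\ell_r)$ with all $\ell_i>0$ and $\sum\ell_i=1$: with $s_0=0$, $s_k=\sum_{i\le k}\ell_i$ and $I_k=[s_{k-1},s_k)$, one sets $T(x)=x-\sum_{i<k}\ell_i+\sum_{\pi(i')<\pi(k)}\ell_{i'}$ for $x\in I_k$. A measure $\mu$ is $T$-ergodic if every $T$-invariant Borel set has $\mu$-measure $0$ or $1$. *)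

(* Defs.v *)
From HB Require Import structures.
From mathcomp Require Import all_boot all_order all_algebra all_fingroup.
From mathcomp Require Import all_classical all_reals all_analysis.
Set Implicit Arguments. Unset Strict Implicit. Unset Printing Implicit Defensive.
Import Order.TTheory GRing.Theory Num.Theory.
Local Open Scope ring_scope.
Local Open Scope classical_set_scope.

(* Interval exchange transformation with r intervals, indices 0..r-1
   (the paper's index k+1 is our k).  With  lft k = sum_{i<k} l_i  and
   rgt k = sum_{i<=k} l_i,  I_k = [lft k, rgt k),  and on I_k
     T x = x - sum_{i<k} l_i + sum_{pi i' < pi k} l_i'.
   Outside [0,1) (where no I_k contains x, given the standing hypotheses)
   T is set to be the identity; this is irrelevant for measures carried
   by [0,1). *)
Section IET.
Variable R : realType.

Definition iet_lft (r : nat) (l : 'I_r -> R) (k : 'I_r) : R :=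
  \sum_(i < r | (i < k)%N) l i.
Definition iet_rgt (r : nat) (l : 'I_r -> R) (k : 'I_r) : R :=
  \sum_(i < r | (i <= k)%N) l i.

Definition iet_map (r : nat) (pi : {perm 'I_r}) (l : 'I_r -> R) (x : R) : R :=
  match [pick k : 'I_r | (iet_lft l k <= x) && (x < iet_rgt l k)] with
  | Some k => x - iet_lft l k + \sum_(i' < r | (pi i' < pi k)%N) l i'
  | None => x
  end.

Definition iet_data (r : nat) (l : 'I_r -> R) : Prop :=
  (2 <= r)%N /\ (forall i, 0 < l i) /\ \sum_(i < r) l i = 1.
End IET.

Definition invariant_measure (d : measure_display) (X : measurableType d)
  (R : realType) (T : X -> X) (mu : set X -> \bar R) : Prop :=
  forall A, measurable A -> mu (T @^-1` A) = mu A.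

Definition ergodic_measure (d : measure_display) (X : measurableType d)
  (R : realType) (T : X -> X) (mu : set X -> \bar R) : Prop :=
  forall A, measurable A -> T @^-1` A = A -> mu A = 0%E \/ mu A = 1%E.

(* Main.v *)
Require Import Defs.
From HB Require Import structures.
From mathcomp Require Import all_boot all_order all_algebra all_fingroup.
From mathcomp Require Import all_classical all_reals all_analysis.
From mathcomp Require Import measurable_realfun zify lra.
Set Implicit Arguments. Unset Strict Implicit. Unset Printing Implicit Defensive.
Import Order.TTheory GRing.Theory Num.Theory.
Local Open Scope ring_scope.
Local Open Scope classical_set_scope.

(* By ergodicity the statement follows from a lower bound, uniform in M, for
   the measure of the pairs (x, y) such that 0 <= n (T^n x - y) <= 2^-m for some
   n >= M.  Approaching y from the right makes the resulting limsup sets forward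
   invariant under (x, y) |-> (T x, y) and (x, y) |-> (T x, T y), because T is a
   translation on a right neighbourhood of every point; hence they have measure
   0 or 1.

   An atom of mu is periodic and gives the bound at once. Otherwise take an
   interval I of small mass. The points of I whose orbit hits an end point of
   an exchanged interval, or of I, up to its first return are at most r + 2 in
   number, since each is found by following such an end point back to its
   first visit to I. Cutting I at them leaves an interval J on which T^i is a
   translation up to the first return, whose tower has N disjoint levels and
   mass at least 2^-(r+2). The levels are disjoint intervals of equal length,
   so N |J| <= 1. Bisect J m times and cut the piece at a median of mu. Pairs
   with x in the right half of a low level and y in the left half of a high
   level satisfy the inequality, n being the difference of the levels, and
   form a product set of mass bounded below. *)

(** * Ergodicity and forward invariant sets *)

Section measure_preserving.
Context {d : measure_display} {X : measurableType d} {R : realType}.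
Variables (mu : probability X R) (T : X -> X).
Hypothesis mT : measurable_fun [set: X] T.
Hypothesis invT : invariant_measure T mu.
Local Open Scope ereal_scope.

Lemma measurable_iter (n : nat) : measurable_fun [set: X] (iter n T).
Proof. by elim: n => [|n IH]; [exact: measurable_id|exact: measurableT_comp mT IH]. Qed.

Lemma measurable_iter_preimage (n : nat) (A : set X) :
  measurable A -> measurable (iter n T @^-1` A).
Proof. by move=> mA; rewrite -[_ @^-1` _]setTI; exact: measurable_iter. Qed.

Lemma measure_iter_preimage (n : nat) (A : set X) :
  measurable A -> mu (iter n T @^-1` A) = mu A.
Proof.
elim: n A => [//|n IH] A mA.
rewrite (_ : _ @^-1` _ = iter n T @^-1` (T @^-1` A)); last by [].
rewrite IH ?invT// -[_ @^-1` _]setTI; exact: mT.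
Qed.

Hypothesis ergT : ergodic_measure T mu.

(** The preimages of [A] under the iterates of [T] increase and all have the mass of [A]. Their
    union is invariant in the strict sense, so ergodicity applies to it, and by continuity from
    below it has the mass of [A] too. *)
Lemma ergodic_forward_invariant (A : set X) : measurable A ->
  A `<=` T @^-1` A -> 0 < mu A -> mu A = 1.
Proof.
move=> mA AT A0; pose F n := iter n T @^-1` A.
have mF n : measurable (F n) by exact: measurable_iter_preimage.
have mU : measurable (\bigcup_n F n) by exact: bigcupT_measurable.
have FS n : F n `<=` F n.+1 by move=> x /AT.
have ndF : {homo F : n m / (n <= m)%N >-> (n <= m)%O}.
  by apply/nondecreasing_seqP => n; apply/subsetPset; exact: FS.
have muF : mu \o F = cst (mu A).
  by apply/funext => n /=; exact: measure_iter_preimage.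
have UE : mu (\bigcup_n F n) = mu A.
  have := nondecreasing_cvg_mu (mu := mu) mF mU ndF.
  rewrite muF => /cvg_lim <- //; exact: lim_cst.
have UT : T @^-1` (\bigcup_n F n) = \bigcup_n F n.
  apply/seteqP; split => x [n _ Fx]; first (exists n.+1 => //).
    by move: Fx; rewrite /F/= -iterSr.
  by exists n => //; move: (FS _ _ Fx); rewrite /F/= -iterSr.
case: (ergT mU UT); rewrite UE // => mA0.
by move: A0; rewrite mA0 ltxx.
Qed.

(** The product system need not be ergodic, so the two invariances are used one after the other. The
    first makes every section at fixed [y] forward invariant, hence null or full. The second makes
    the mass of the section nondecreasing along orbits, so the set [Y] of those [y] with a full
    section is forward invariant as well, and [Y] has the mass of [A]. *)
Lemma product_forward_invariant (A : set (X * X)) : measurable A ->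
  (forall x y, A (x, y) -> A (T x, y)) ->
  (forall x y, A (x, y) -> A (T x, T y)) ->
  0 < (mu \x mu) A -> (mu \x mu) A = 1.
Proof.
move=> mA AT1 AT2.
have -> : (mu \x mu) A = \int[mu]_y mu (ysection A y).
  rewrite /product_measure1 -(indic_fubini_tonelli_FE mu mA).
  rewrite [LHS](indic_fubini_tonelli mu mu mA).
  by rewrite (indic_fubini_tonelli_GE mu mA).
pose f : X -> \bar R := fun y => mu (ysection A y).
have mf : measurable_fun [set: X] f by exact: measurable_fun_ysection.
have mS y : measurable (ysection A y) by exact: measurable_ysection.
have fT y : f y <= f (T y).
  rewrite /f -[leRHS](invT (mS _)) le_measure ?inE //.
    by rewrite -[_ @^-1` _]setTI; apply: mT.
  by move=> x; rewrite /ysection/= !inE => /AT2.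
have f1 y : 0 < f y -> f y = 1.
  move=> fy; apply: ergodic_forward_invariant => // x.
  by rewrite /ysection/= !inE => /AT1.
pose Y := [set y | 0 < f y].
have mY : measurable Y.
  rewrite (_ : Y = f @^-1` `]0, +oo[); last first.
    apply/seteqP; split => y /=; rewrite /Y/= in_itv/= ?andbT// => ->//=.
  by rewrite -[_ @^-1` _]setTI; apply: mf => //; exact: emeasurable_itv.
have intE : \int[mu]_y f y = mu Y.
  rewrite (_ : mu Y = \int[mu]_y (\1_Y y)%:E); last by rewrite integral_indic ?setIT.
  apply: eq_integral => y _; rewrite indicE.
  case: (boolP (y \in Y)); rewrite ?inE ?notin_setE /Y/= => h.
    by rewrite f1.
  apply/eqP; rewrite eq_le measure_ge0 andbT leNgt; exact/negP.
rewrite -/f intE => Y0.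
apply: (@ergodic_forward_invariant Y mY _ Y0) => y.
by rewrite /Y/= => fy; apply: lt_le_trans fy _; exact: fT.
Qed.

End measure_preserving.

(** * Shrinking an interval while keeping a share of a subadditive weight *)

Section interval_splitting.
Context {R : realType}.
Variable nu : set R -> R.
Hypothesis nu_ge0 : forall A, 0 <= nu A.
Hypothesis nuU : forall u w v, u < w -> w < v ->
  nu `[u, v[ <= nu `[u, w[ + nu `[w, v[.

Lemma half_itv_ge (u w v : R) : u < w -> w < v ->
  (nu `[u, v[ <= 2 * nu `[u, w[) \/ (nu `[u, v[ <= 2 * nu `[w, v[).
Proof.
move=> uw wv; have := nuU uw wv.
by case: (leP (nu `[u, w[) (nu `[w, v[)) => h le; [right|left]; lra.
Qed.

(** Each point of [s] strictly inside the current interval cuts it in two and the heavier part is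
    kept, at the cost of a factor 2. A point of [s] may remain as the left end [u], which half-open
    intervals tolerate. *)
Lemma exists_itv_avoiding (s : seq R) (a b : R) : a < b ->
  exists u v, [/\ a <= u, u < v, v <= b,
    forall d, d \in s -> u < d -> v <= d &
    nu `[a, b[ <= 2 ^+ size s * nu `[u, v[].
Proof.
move=> ab; elim: s => [|d s [u [v [au uv vb sP le]]]].
  by exists a, b; split => //=; rewrite expr0 mul1r.
have le2 x y : nu `[u, v[ <= 2 * nu `[x, y[ ->
    nu `[a, b[ <= 2 ^+ size (d :: s) * nu `[x, y[.
  move=> h; rewrite /= exprSr -mulrA; apply: le_trans le _.
  by rewrite ler_wpM2l// exprn_ge0.
case: (ltP u d) => ud; last first.
  exists u, v; split => // [e|]; last by apply: le2; have := nu_ge0 `[u, v[; lra.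
  by rewrite inE => /predU1P[->|/sP//]; rewrite ltNge ud.
case: (ltP d v) => dv; last first.
  exists u, v; split => // [e|]; last by apply: le2; have := nu_ge0 `[u, v[; lra.
  by rewrite inE => /predU1P[->|/sP//].
have [h|h] := half_itv_ge ud dv.
  exists u, d; split => //; [exact: le_trans (ltW dv) vb| |exact: le2].
  move=> e; rewrite inE => /predU1P[-> //|/sP h' /h' ve].
  exact: le_trans (ltW dv) ve.
exists d, v; split => //; [exact: le_trans au (ltW ud)| |exact: le2].
move=> e; rewrite inE => /predU1P[->|/sP h' de]; first by rewrite ltxx.
exact/h'/(lt_trans ud).
Qed.

Lemma exists_itv_dyadic (m : nat) (a b : R) : a < b ->
  exists u v, [/\ a <= u, u < v, v <= b, v - u = (b - a) / 2 ^+ m &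
    nu `[a, b[ <= 2 ^+ m * nu `[u, v[].
Proof.
move=> ab; elim: m => [|m [u [v [au uv vb uvE le]]]].
  by exists a, b; split => //; rewrite expr0 ?mul1r// divr1.
have le2 x y : nu `[u, v[ <= 2 * nu `[x, y[ ->
    nu `[a, b[ <= 2 ^+ m.+1 * nu `[x, y[.
  move=> h; rewrite /= exprSr -mulrA; apply: le_trans le _.
  by rewrite ler_wpM2l// exprn_ge0.
have E : (v - u) / 2 = (b - a) / 2 ^+ m.+1 by rewrite uvE exprSr invfM mulrA.
pose w := (u + v) / 2.
have [uw wv] : u < w /\ w < v by split; rewrite /w; lra.
have [h|h] := half_itv_ge uw wv.
  exists u, w; split => //; [lra| |exact: le2].
  by rewrite -E /w; lra.
exists w, v; split => //; [lra| |exact: le2].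
by rewrite -E /w; lra.
Qed.
End interval_splitting.

(** * Monotone limits and finite unions *)

Section measure_continuity.
Context {d : measure_display} {X : measurableType d} {R : realType}.
Variable mu : {measure set X -> \bar R}.
Local Open Scope ereal_scope.

Lemma nondecreasing_measure_le (F : (set X)^nat) (c : \bar R) :
  (forall i, measurable (F i)) -> (forall n, F n `<=` F n.+1) ->
  (forall n, mu (F n) <= c) -> mu (\bigcup_n F n) <= c.
Proof.
move=> mF FS Fc.
have ndF : {homo F : n m / (n <= m)%N >-> (n <= m)%O}.
  by apply/nondecreasing_seqP => n; apply/subsetPset; exact: FS.
have cv := nondecreasing_cvg_mu (mu := mu) mF (bigcupT_measurable _ mF) ndF.
rewrite -(cvg_lim _ cv)//; apply: lime_le; first exact: cvgP cv.
exact: nearW.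
Qed.

Lemma nonincreasing_measure_ge (F : (set X)^nat) (c : \bar R) :
  mu (F 0%N) < +oo ->
  (forall i, measurable (F i)) -> (forall n, F n.+1 `<=` F n) ->
  (forall n, c <= mu (F n)) -> c <= mu (\bigcap_n F n).
Proof.
move=> F0 mF FS Fc.
have niF : {homo F : n m / (n <= m)%N >-> (m <= n)%O}.
  by apply/nonincreasing_seqP => n; apply/subsetPset; exact: FS.
have cv := nonincreasing_cvg_mu F0 mF (bigcapT_measurable mF) niF.
rewrite -(cvg_lim _ cv)//; apply: lime_ge; first exact: cvgP cv.
exact: nearW.
Qed.

Lemma measure_bigcup_ord (n : nat) (F : nat -> set X) :
  (forall i, measurable (F i)) -> trivIset `I_n F ->
  mu (\bigcup_(i < n) F i) = \sum_(i < n) mu (F i).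
Proof.
move=> mF tF; rewrite measure_fin_bigcup// -?fsbig_ord//; exact: finite_II.
Qed.

Lemma measure_bigcup_ord_le (n : nat) (F : nat -> set X) (A : set X) :
  measurable A -> (forall i, measurable (F i)) -> A `<=` \bigcup_(i < n) F i ->
  mu A <= \sum_(i < n) mu (F i).
Proof.
by move=> mA mF AF; apply: content_subadditive => //; rewrite -bigcup_mkord.
Qed.

End measure_continuity.

(** * Quantiles of a probability on the line *)

Section quantile.
Context {R : realType}.
Variable mu : probability R R.

(** Take for [s] the infimum of the points where the distribution function is at least [q]; [a]
    bounds this set below and [b] belongs to it. Continuity from above along [s + 1/(n+1)] gives the
    first inequality, continuity from below along [s - 1/(n+1)] the second. *)
Lemma exists_quantile (a b : R) (q : \bar R) :
  (mu `]-oo, a] < q)%E -> (q <= mu `]-oo, b])%E ->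
  exists s, (q <= mu `]-oo, s])%E /\ (mu `]-oo, s[ <= q)%E.
Proof.
move=> qa qb; pose E := [set t | (q <= mu `]-oo, t])%E].
have leF (x y : R) : x <= y -> (mu `]-oo, x] <= mu `]-oo, y])%E.
  move=> xy; rewrite le_measure ?inE //= => z /=; rewrite !in_itv/= => zx.
  exact: le_trans zx xy.
have lbE : lbound E a.
  move=> t Et; rewrite leNgt; apply/negP => ta.
  by have := lt_le_trans qa (le_trans Et (leF _ _ (ltW ta))); rewrite ltxx.
have hE : has_inf E by split; [exists b|exists a].
pose s := inf E; exists s; split.
  rewrite (_ : `]-oo, s] = \bigcap_n `]-oo, s + n.+1%:R^-1]); last first.
    apply/seteqP; split => x /=; rewrite in_itv/= => h.
      by move=> n _ /=; rewrite in_itv/= ler_wpDr// invr_ge0.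
    apply/ler_addgt0Pr => e e0.
    have := h (Num.trunc e^-1) I; rewrite /= in_itv/= => /le_trans; apply.
    rewrite lerD2l invf_ple ?posrE//; exact/ltW/truncnS_gt.
  apply: nonincreasing_measure_ge => //.
  - by rewrite (le_lt_trans (probability_le1 _ _))// ltry.
  - move=> n x /=; rewrite !in_itv/= => /le_trans; apply.
    by rewrite lerD2l lef_pV2 ?posrE// ler_nat.
  - move=> n; have [t Et /ltW ts] : exists2 t, E t & t < s + n.+1%:R^-1.
      by apply: inf_adherent.
    exact: le_trans Et (leF _ _ ts).
rewrite (_ : `]-oo, s[ = \bigcup_n `]-oo, s - n.+1%:R^-1]); last first.
  apply/seteqP; split => x /=; rewrite in_itv/=.
    move=> xs; exists (Num.trunc (s - x)^-1) => //=; rewrite in_itv/=.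
    rewrite lerBrDr -lerBrDl invf_ple ?posrE ?subr_gt0//.
    exact/ltW/truncnS_gt.
  by move=> [n _ /=]; rewrite in_itv/= => /le_lt_trans; apply; rewrite ltrBlDr ltrDl.
apply: nondecreasing_measure_le => //.
- move=> n x /=; rewrite !in_itv/= => /le_trans; apply.
  by rewrite lerD2l lerN2 lef_pV2 ?posrE// ler_nat.
- move=> n; rewrite leNgt; apply/negP => /ltW h.
  have := ge_inf hE.2 h; rewrite leNgt => /negP; apply.
  by rewrite ltrBlDr ltrDl invr_gt0.
Qed.

End quantile.

(** * The exchanged intervals partition [0,1) *)

Section iet_intervals.
Context {R : realType} {r : nat}.
Variable l : 'I_r -> R.
Hypothesis hl : iet_data l.

Let l_gt0 i : 0 < l i. Proof. by have [_ [+ _]] := hl; exact. Qed.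

Lemma iet_lft_ge0 k : 0 <= iet_lft l k.
Proof. by apply: sumr_ge0 => i _; exact: ltW. Qed.

Lemma iet_rgtE k : iet_rgt l k = iet_lft l k + l k.
Proof.
rewrite /iet_rgt /iet_lft (bigD1 k)//= addrC; congr (_ + _).
by apply: eq_bigl => i; rewrite ltn_neqAle andbC -val_eqE.
Qed.

Lemma iet_rgt_le_lft (j k : 'I_r) : (j < k)%N -> iet_rgt l j <= iet_lft l k.
Proof.
move=> jk; rewrite /iet_rgt /iet_lft big_mkcond [leRHS]big_mkcond/=.
apply: ler_sum => i _; case: ifPn => ij; first by rewrite (leq_ltn_trans ij jk).
by case: ifP => // _; exact: ltW.
Qed.

Lemma iet_rgt_le1 k : iet_rgt l k <= 1.
Proof.
have [_ [_ <-]] := hl; rewrite /iet_rgt big_mkcond/=.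
by apply: ler_sum => i _; case: ifP => // _; exact: ltW.
Qed.

(** The index is the least one whose right end exceeds [x]: its left end is 0 or the right end of
    its predecessor. *)
Lemma iet_itv_cover x : 0 <= x -> x < 1 ->
  exists k, iet_lft l k <= x < iet_rgt l k.
Proof.
move=> x0 x1; have [r2 [_ l1]] := hl.
have r0 : (0 < r)%N by exact: ltn_trans r2.
pose last := Ordinal (etrans (congr1 (leq^~ r) (prednK r0)) (leqnn r)).
have xl : x < iet_rgt l last.
  rewrite /iet_rgt (_ : \sum_(i < r | _) _ = 1)// -l1.
  by apply: eq_bigl => i /=; rewrite -ltnS prednK ?ltn_ord.
have [k xk kmin] := @arg_minnP _ last (fun k => x < iet_rgt l k) val xl.
exists k; rewrite xk andbT.
have [k0|k0] := posnP k.
  by rewrite /iet_lft big_pred0// => i; rewrite k0.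
have kr : (k.-1 < r)%N by exact: leq_ltn_trans (leq_pred _) (ltn_ord k).
have -> : iet_lft l k = iet_rgt l (Ordinal kr).
  by apply: eq_bigl => i /=; rewrite -[in RHS]ltnS prednK.
rewrite leNgt; apply/negP => /kmin /=; by rewrite leqNgt prednK// leqnn.
Qed.

Lemma iet_itv_uniq x j k : iet_lft l j <= x < iet_rgt l j ->
  iet_lft l k <= x < iet_rgt l k -> j = k.
Proof.
move=> /andP[xj jx] /andP[xk kx]; apply/val_inj/eqP; rewrite eqn_leq.
apply/andP; split; rewrite leqNgt; apply/negP => /iet_rgt_le_lft h.
  by have := lt_le_trans kx (le_trans h xj); rewrite ltxx.
by have := lt_le_trans jx (le_trans h xk); rewrite ltxx.
Qed.

Lemma iet_itv01 x k : iet_lft l k <= x < iet_rgt l k -> 0 <= x < 1.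
Proof.
move=> /andP[xk kx]; rewrite (le_trans (iet_lft_ge0 k) xk)/=.
exact: lt_le_trans kx (iet_rgt_le1 k).
Qed.

End iet_intervals.

(** * The interval exchange as a measurable bijection and a piecewise translation *)

Section iet_bijection.
Context {R : realType} {r : nat}.
Implicit Types (l : 'I_r -> R) (pi : {perm 'I_r}).

(** The inverse is again an interval exchange, with the lengths listed in the order of the image
    intervals, so facts about [iet_map] such as measurability apply to it directly. *)
Definition iet_inv pi l : R -> R := iet_map pi^-1%g (l \o pi^-1%g).

Lemma iet_data_inv pi l : iet_data l -> iet_data (l \o pi^-1%g).
Proof.
move=> [r2 [l0 l1]]; split => //; split => [i|/=]; first exact: l0.
by rewrite -l1 [RHS](reindex_inj (@perm_inj _ pi^-1%g)).
Qed.

Lemma iet_mapE pi l (k : 'I_r) x : iet_data l ->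
  iet_lft l k <= x < iet_rgt l k ->
  iet_map pi l x = x - iet_lft l k + iet_lft (l \o pi^-1%g) (pi k).
Proof.
move=> hl xk; rewrite /iet_map; case: pickP => [j xj|/(_ k)]; last by rewrite xk.
rewrite (iet_itv_uniq hl xj xk); congr (_ + _).
rewrite /iet_lft [RHS](reindex_inj (@perm_inj _ pi))/=.
by apply: eq_bigr => i _; rewrite /= permK.
Qed.

Lemma iet_map_out pi l x : iet_data l -> ~~ (0 <= x < 1) -> iet_map pi l x = x.
Proof.
move=> hl xn; rewrite /iet_map; case: pickP => [j xj|//].
by rewrite (iet_itv01 hl xj) in xn.
Qed.

Lemma iet_map_itv pi l (k : 'I_r) x : iet_data l ->
  iet_lft l k <= x < iet_rgt l k ->
  iet_lft (l \o pi^-1%g) (pi k) <= iet_map pi l x < iet_rgt (l \o pi^-1%g) (pi k).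
Proof.
move=> hl xk; rewrite (iet_mapE pi hl xk) iet_rgtE /= permK.
by move: xk; rewrite iet_rgtE => /andP[? ?]; apply/andP; split; lra.
Qed.

Lemma iet_map01 pi l x : iet_data l -> 0 <= x < 1 -> 0 <= iet_map pi l x < 1.
Proof.
move=> hl /andP[x0 x1]; have [k /(iet_map_itv pi hl)] := iet_itv_cover hl x0 x1.
exact/iet_itv01/iet_data_inv.
Qed.

Lemma iet_mapK pi l : iet_data l -> cancel (iet_map pi l) (iet_inv pi l).
Proof.
move=> hl x; have [x01|xn] := boolP (0 <= x < 1); last first.
  by rewrite /iet_inv !iet_map_out//; exact: iet_data_inv.
have /andP[x0 x1] := x01; have [k xk] := iet_itv_cover hl x0 x1.
rewrite /iet_inv (iet_mapE pi^-1%g (iet_data_inv pi hl) (iet_map_itv pi hl xk)).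
rewrite (iet_mapE pi hl xk) permK invgK.
rewrite (_ : _ \o pi = l); last by apply/funext => i /=; rewrite permK.
lra.
Qed.

Lemma iet_invK pi l : iet_data l -> cancel (iet_inv pi l) (iet_map pi l).
Proof.
move=> hl; have := iet_mapK pi^-1%g (iet_data_inv pi hl).
rewrite {1}/iet_inv invgK (_ : _ \o pi = l)//.
by apply/funext => i /=; rewrite permK.
Qed.

(** The map is the identity plus a finite combination of indicators, a formula that also covers the
    points outside [0,1), where all indicators vanish. *)
Lemma measurable_iet_map pi l : iet_data l -> measurable_fun [set: R] (iet_map pi l).
Proof.
move=> hl; pose c k := iet_lft (l \o pi^-1%g) (pi k) - iet_lft l k.
pose I k : set R := (`[iet_lft l k, iet_rgt l k[)%classic.
have -> : iet_map pi l = fun x => x + \sum_(k <- index_enum 'I_r) c k * \1_(I k) x.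
  apply/funext => x; have [x01|xn] := boolP (0 <= x < 1); last first.
    rewrite iet_map_out// big1 ?addr0// => k _.
    rewrite indicE memNset ?mulr0// /I/= in_itv/= => xk.
    by rewrite (iet_itv01 hl xk) in xn.
  have /andP[x0 x1] := x01; have [k xk] := iet_itv_cover hl x0 x1.
  rewrite (iet_mapE pi hl xk) (bigD1 k)//= big1 => [|j jk].
    by rewrite indicE mem_set ?mulr1 ?addr0 /I/= ?in_itv//= /c; lra.
  rewrite indicE memNset ?mulr0// /I/= in_itv/= => xj.
  by rewrite (iet_itv_uniq hl xj xk) eqxx in jk.
have mI (k : 'I_r) : measurable_fun [set: R] (fun x => c k * \1_(I k) x).
  apply: measurable_funM; first exact: measurable_cst.
  by apply: measurable_indic; exact: measurable_itv.
have mS := measurable_sum (index_enum 'I_r) mI.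
exact: measurable_funD (@measurable_id _ _ _) mS.
Qed.

(** The exchanged interval that holds [u] ends after [u], hence not before [v], and so contains the
    whole of [[u, v)]. *)
Lemma iet_map_translation pi l u v : iet_data l -> 0 <= u -> v <= 1 -> u < v ->
  (forall k, u < iet_rgt l k -> v <= iet_rgt l k) ->
  exists c, forall x, u <= x < v -> iet_map pi l x = x + c.
Proof.
move=> hl u0 v1 uv h.
have [k /andP[ku uk]] := iet_itv_cover hl u0 (lt_le_trans uv v1).
exists (iet_lft (l \o pi^-1%g) (pi k) - iet_lft l k) => x /andP[ux xv].
rewrite (@iet_mapE pi l k _)// ?(le_trans ku ux) ?(lt_le_trans xv (h _ uk))//; lra.
Qed.

(** Exchanged intervals are closed on the left, so even a discontinuity has room on its right.
    Outside [0,1) the map is the identity, and a negative [y] has room up to 0. *)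
Lemma iet_map_right_translation pi l y : iet_data l -> exists2 e : R, 0 < e &
  forall z, y <= z < y + e -> iet_map pi l z - iet_map pi l y = z - y.
Proof.
move=> hl; have [y01|yn] := boolP (0 <= y < 1).
  have /andP[y0 y1] := y01; have [k yk] := iet_itv_cover hl y0 y1.
  exists (iet_rgt l k - y); first by case/andP: yk => _; lra.
  move=> z /andP[yz zy]; rewrite (iet_mapE pi hl yk) (@iet_mapE pi l k _)//; first lra.
  by case/andP: yk => ? ?; apply/andP; split; lra.
have [y0|y0] := ltP y 0.
  exists (- y); first lra.
  move=> z /andP[yz zy]; rewrite !iet_map_out// -?leNgt; apply/negP => /andP[]; lra.
exists 1 => // z /andP[yz zy].
move: yn; rewrite y0/= -leNgt => y1.
rewrite !iet_map_out// ; apply/negP => /andP[]; lra.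
Qed.

End iet_bijection.

(** * Towers over an interval *)

Lemma iter_cancel (X : Type) (f g : X -> X) (i j : nat) (x : X) :
  cancel f g -> (i <= j)%N -> iter i g (iter j f x) = iter (j - i) f x.
Proof.
move=> fK /subnKC {1}<-; elim: i (j - i)%N => [//|i IH] k.
by rewrite addSn iterSr/= fK IH.
Qed.

(* The points whose first backward visit to I lies in X. *)
Definition backward_tower (R : realType) (S : R -> R) (I X : set R) : set R :=
  [set z | exists i, X (iter i S z) /\ forall k, (k < i)%N -> ~ I (iter k S z)].

Section tower.
Context {R : realType}.
Variables (mu : probability R R) (T S : R -> R) (D : seq R).
Hypotheses (mT : measurable_fun [set: R] T) (mS : measurable_fun [set: R] S).
Hypotheses (TK : cancel T S) (SK : cancel S T).
Hypotheses (invT : invariant_measure T mu) (ergT : ergodic_measure T mu).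
Hypothesis T01 : forall x : R, 0 <= x < 1 -> 0 <= T x < 1.
Hypothesis trT : forall u v : R, 0 <= u -> v <= 1 -> u < v ->
  (forall d, d \in D -> u < d -> v <= d) ->
  exists c, forall x : R, u <= x < v -> T x = x + c.

Lemma invariant_inverse : invariant_measure S mu.
Proof.
move=> A mA; rewrite -invT; last by rewrite -[_ @^-1` _]setTI; exact: mS.
by congr (mu _); apply/seteqP; split => x /=; rewrite TK.
Qed.

Lemma iter01 n x : 0 <= x < 1 -> 0 <= iter n T x < 1.
Proof. by elim: n => //= n IH /IH; exact: T01. Qed.

Lemma measurable_backward_tower (I X : set R) :
  measurable I -> measurable X -> measurable (backward_tower S I X).
Proof.
move=> mI mX; rewrite (_ : backward_tower S I X = \bigcup_i
    (iter i S @^-1` X `&` \bigcap_(k in `I_i) iter k S @^-1` (~` I))).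
  apply: bigcupT_measurable => i; apply: measurableI.
    exact: measurable_iter_preimage.
  apply: bigcap_measurableType => k _; apply: measurable_iter_preimage => //.
  exact: measurableC.
apply/seteqP; split => [z [i [Xi Ii]]|z [i _ [Xi Ii]]]; last by exists i.
by exists i => //; split => // k; exact: Ii.
Qed.

(** If [z] meets [I] going backwards, then [T z] does so after at most one step more, and the least
    such time is its first visit. The tower is thus forward invariant, and it contains [I]. *)
Lemma measure_backward_tower (I : set R) : measurable I -> (0 < mu I)%E ->
  mu (backward_tower S I I) = 1%E.
Proof.
move=> mI I0; have mB := measurable_backward_tower mI mI.
apply: (@ergodic_forward_invariant _ _ _ mu T mT invT ergT _ mB).
  move=> z [i [Ii _]] /=.
  pose P n := `[< I (iter n S (T z)) >].
  have : exists n, P n by exists i.+1; apply/asboolP; rewrite iterSr TK.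
  move=> /ex_minnP[n /asboolP In nmin]; exists n; split => // k kn Ik.
  by have := nmin k (asboolT Ik); rewrite leqNgt kn.
apply: lt_le_trans I0 _; rewrite le_measure ?inE// => z Iz.
by exists 0%N; split.
Qed.

(** If some point of [[u, v)] returns to [[a, b)], [N] is the first time this happens. After the
    cuts all points return together, so the backward tower over [[u, v)] has at most [N] levels. The
    one over [[a, b)] is full by ergodicity, and each of the [size D + 2] cuts costs a factor 2. *)
Lemma exists_tower (a b : R) : 0 <= a -> b <= 1 -> (0 < mu `[a, b[)%E ->
  exists u v N, [/\ a <= u, u < v, v <= b &
   [/\ forall i x, (i < N)%N -> u <= x < v ->
        iter i T x = x + (iter i T u - u),
      forall i j x y, (i < j < N)%N -> u <= x < v -> u <= y < v ->
        iter i T x <> iter j T y &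
      1 <= 2 ^+ (size D).+2 * (N%:R * fine (mu `[u, v[))]].
Proof.
move=> a0 b1 I0; set I : set R := (`[a, b[)%classic in I0 *.
have mI : measurable I by exact: measurable_itv.
have ab : a < b.
  rewrite ltNge; apply/negP => ba; move: I0; rewrite /I set_itv_ge ?measure0 ?ltxx//.
  by rewrite bnd_simp -leNgt.
pose first_visit d x := exists i, [/\ x = iter i S d, I x &
  forall k, (k < i)%N -> ~ I (iter k S d)].
(* The default 0 is never strictly inside [I], since [0 <= a], so it causes no cut. *)
pose f d := xget 0 [set x | first_visit d x].
have fP d x : first_visit d x -> f d = x.
  move=> fx; apply: xget_unique => // y [j [-> Iy jmin]].
  have [i [-> Ix imin]] := fx.
  case: (ltngtP i j) => [ij|ji|->//]; last by case: (imin j ji).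
  by case: (jmin i ij).
(* The weight that guides the cutting is the mass of the tower over a piece, not of the piece
   itself. *)
pose nu X := fine (mu (backward_tower S I X)).
have mW X : measurable X -> measurable (backward_tower S I X).
  exact: measurable_backward_tower.
have nu_ge0 X : 0 <= nu X by exact/fine_ge0/measure_ge0.
have mWi (x y : R) : measurable (backward_tower S I `[x, y[).
  by apply: mW; exact: measurable_itv.
have nuU (u w v : R) : u < w -> w < v ->
    nu `[u, v[ <= nu `[u, w[ + nu `[w, v[.
  move=> uw wv; rewrite /nu -fineD ?fin_num_measure//.
  apply: fine_le; rewrite ?fin_numD ?fin_num_measure//.
  apply: le_trans (measureU2 _ (mWi u w) (mWi w v)); rewrite le_measure ?inE//.
    exact: measurableU.
  move=> z [i [/= zi h]]; rewrite in_itv/= in zi.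
  have [zw|zw] := ltP (iter i S z) w; [left|right]; exists i;
    by split => //=; rewrite in_itv/= ?zw ?andbT//; case/andP: zi.
(* f d is the cut point of I coming from d, if there is one. *)
have [u [v [au uv vb sP le]]] :=
  exists_itv_avoiding nu_ge0 nuU (map f (D ++ [:: S a; S b])) ab.
rewrite size_map size_cat addn2 {1}/nu measure_backward_tower//= in le.
set J : set R := (`[u, v[)%classic in le *.
have mJ : measurable J by exact: measurable_itv.
have JE x : J x = (u <= x < v) :> Prop by rewrite /J/= in_itv.
have JI x : J x -> I x.
  by rewrite JE /I/= in_itv/= => /andP[ux xv]; rewrite (le_trans au)// (lt_le_trans xv).
have I01 x : I x -> 0 <= x < 1.
  by rewrite /I/= in_itv/= => /andP[ax xb]; rewrite (le_trans a0)// (lt_le_trans xb).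
have Ju : J u by rewrite JE lexx.
(* A point reaching [d] with no return to [I] on the way is the first backward visit of [d], that is
   [f d], and [sP] keeps [f d] out of the interior of [J]. *)
have nofv d n x : d \in D ++ [:: S a; S b] -> u < x < v -> iter n T x = d ->
    (forall j, (0 < j <= n)%N -> ~ I (iter j T x)) -> False.
  move=> dD /andP[ux xv] nx nI.
  have Sx k : (k <= n)%N -> iter k S d = iter (n - k) T x.
    by move=> kn; rewrite -nx iter_cancel.
  have : f d = x.
    apply: fP; exists n; split; first by rewrite Sx// subnn.
      by apply: JI; rewrite JE (ltW ux) xv.
    by move=> k kn; rewrite Sx; [apply: nI; rewrite subn_gt0 kn leq_subr|exact: ltnW].
  move=> fd; have := sP x; rewrite -{1}fd map_f// => /(_ isT ux).
  by rewrite leNgt xv.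
(* By induction the image of [J] at time [n] is [[u + c, v + c)]. A point [d] of [D] strictly inside
   it would come from [d - c] in the interior of [J], against [nofv], so one more step is again a
   translation. *)
have tr n : (forall j x, (0 < j < n)%N -> J x -> ~ I (iter j T x)) ->
    forall x, J x -> iter n T x = x + (iter n T u - u).
  move=> nI; suff [c h] : exists c, forall x, J x -> iter n T x = x + c.
    by move=> x Jx; rewrite !h//; lra.
  elim: n nI => [|n IH] nI; first by exists 0 => x _; rewrite addr0.
  have [j x /andP[j0 jn] Jx|c h] := IH; first by apply: nI => //; rewrite j0 ltnW.
  have [||||c' h'] := @trT (u + c) (v + c).
  - by have := iter01 n (I01 _ (JI _ Ju)); rewrite h// => /andP[].
  - rewrite leNgt; apply/negP => vc.
    (* If [v + c] exceeded 1, this point of [J] would be carried to 1 or beyond. *)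
    pose x := Num.max u (1 - c).
    have Jx : J x by rewrite JE /x le_max lexx gt_max uv/=; lra.
    have := iter01 n (I01 _ (JI _ Jx)); rewrite h// => /andP[_].
    have : 1 - c <= x by rewrite /x le_max lexx orbT.
    lra.
  - lra.
  - move=> d dD ud; rewrite leNgt; apply/negP => dv.
    apply: (@nofv d n (d - c)); [by rewrite mem_cat dD|lra| |].
      by rewrite h ?JE; lra.
    move=> j jn; apply: (nI j _ jn); rewrite JE; lra.
  exists (c + c') => x Jx; rewrite /= h// h'; first lra.
  by move: Jx; rewrite JE; lra.
have muS i : mu (iter i S @^-1` J) = mu J.
  exact: measure_iter_preimage mS invariant_inverse _ _ mJ.
(* If [J] were null, the tower over it would be null too, against [le]. *)
have J0 : 0 < fine (mu J).
  apply: fine_gt0; rewrite ltey_eq fin_num_measure// andbT lt0e measure_ge0.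
  rewrite andbT; apply/negP => /eqP J0.
  suff : nu J = 0 by move=> h; move: le; rewrite -/J h mulr0; lra.
  rewrite /nu; suff -> : mu (backward_tower S I J) = 0%E by [].
  apply/(negligibleP mu); first exact: mW.
  apply: (@negligibleS _ _ _ mu (\bigcup_i iter i S @^-1` J)).
    by move=> z [i [Ji _]]; exists i.
  apply: negligible_bigcup => i; apply/negligibleP.
    exact: measurable_iter_preimage.
  exact: etrans (muS i) J0.
have [ret|noret] := pselect (exists n, (0 < n)%N /\ exists2 x, J x & I (iter n T x)).
  have : exists n, `[< (0 < n)%N /\ exists2 x, J x & I (iter n T x) >].
    by have [n hn] := ret; exists n; apply/asboolP.
  move=> /ex_minnP[h /asboolP[h0 [x0 Jx0 Ix0]] hmin].
  have nI j x : (0 < j < h)%N -> J x -> ~ I (iter j T x).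
    move=> /andP[j0 jh] Jx Ij; suff : (h <= j)%N by rewrite leqNgt jh.
    by apply: hmin; apply/asboolP; split => //; exists x.
  have hE := tr h nI; set c := iter h T u - u in hE.
  have hS x y : iter h T x = y -> iter h.-1 T x = S y.
    by move=> <-; rewrite -{2}(prednK h0) /= TK.
  (* This is why the list of cuts holds [S a] and [S b]: the time just before the return is still
     outside [I] or equal to 0, whereas [a] lies in [I] and would be its own first backward
     visit. *)
  have noend e x : e \in [:: a; b] -> u < x < v -> iter h T x <> e.
    move=> eab xuv /hS hx; apply: (@nofv (S e) h.-1 x) => //.
      rewrite mem_cat; apply/orP; right.
      by move: eab; rewrite !inE => /orP[]/eqP ->; rewrite eqxx ?orbT.
    move=> j /andP[j0 jh]; apply: nI.
      by rewrite j0 -(prednK h0) ltnS.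
    by rewrite JE; case/andP: xuv => /ltW -> ->.
  (* One point of [J], namely [x0], is in [I] at time [h]. If another were not, an end of [I] would
     be the image of an interior point of [J]. *)
  have JhI x : J x -> I (iter h T x).
    move=> Jx; move: (Jx) (Jx0) Ix0; rewrite !hE// /I/= !in_itv/= !JE.
    move=> /andP[ux xv] /andP[ux0 x0v] /andP[ax bx]; apply/andP; split.
      rewrite leNgt; apply/negP => xa.
      apply: (@noend a (a - c)); rewrite ?inE ?eqxx//; first lra.
      by rewrite hE ?JE; lra.
    rewrite ltNge; apply/negP => xa.
    apply: (@noend b (b - c)); rewrite ?inE ?eqxx ?orbT//; first lra.
    by rewrite hE ?JE; lra.
  exists u, v, h; split => //; split.
  - move=> i x ih; rewrite -JE => Jx; apply: tr => // j y /andP[j0 ji].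
    by apply: nI; rewrite j0 (ltn_trans ji).
  - move=> i j x y /andP[ij jh]; rewrite -!JE => Jx Jy xy.
    apply: (nI (j - i)%N y) => //.
      by rewrite subn_gt0 ij (leq_ltn_trans (leq_subr _ _) jh).
    by rewrite -(iter_cancel y TK (ltnW ij)) -xy iter_cancel// subnn; exact: JI.
  - apply: le_trans le _; rewrite ler_wpM2l ?exprn_ge0//.
    (* A point at depth [i >= h] above [J] would already have visited [I] at depth [i - h], by
       [JhI]; so the tower lies in the first [h] levels. *)
    have : (mu (backward_tower S I J) <= (h%:R * fine (mu J))%:E)%E.
      apply: le_trans (@measure_bigcup_ord_le _ _ _ mu h
        (fun i => iter i S @^-1` J) _ (mW _ mJ) _ _) _.
      + by move=> i; exact: measurable_iter_preimage.
      + move=> z [i [Ji nJ]]; exists i => //=; rewrite ltnNge; apply/negP => hi.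
        apply: (nJ (i - h)%N); first by rewrite ltn_subrL h0 (leq_trans h0 hi).
        by rewrite -(iter_cancel z SK hi); exact: JhI.
      rewrite (eq_bigr (fun=> (fine (mu J))%:E)) => [|i _].
        by rewrite sumEFin sumr_const card_ord mulr_natl.
      exact: etrans (muS i) (esym (fineK (fin_num_measure mu _ mJ))).
    by rewrite -lee_fin /nu fineK ?fin_num_measure//; exact: mW.
have nI j x : (0 < j)%N -> J x -> ~ I (iter j T x).
  by move=> j0 Jx Ij; apply: noret; exists j; split => //; exists x.
(* If [J] never returns, every height is allowed; this one makes [N * mu J] at least 1. *)
exists u, v, (Num.trunc (fine (mu J))^-1).+1; split => //; split.
- by move=> i x _; rewrite -JE => Jx; apply: tr => // j y /andP[j0 _]; exact: nI.
- move=> i j x y /andP[ij _]; rewrite -!JE => Jx Jy xy.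
  apply: (nI (j - i)%N y) => //; first by rewrite subn_gt0.
  by rewrite -(iter_cancel y TK (ltnW ij)) -xy iter_cancel// subnn; exact: JI.
- rewrite -[leLHS]mulr1; apply: ler_pM => //.
    by rewrite exprn_ege1// ler1n.
  by rewrite -ler_pdivrMr// div1r; exact/ltW/truncnS_gt.
Qed.

End tower.

(** * Medians of a probability carried by [0,1) *)

Section half_mass.
Context {R : realType}.
Variable mu : probability R R.
Hypothesis mu01 : mu `[0, 1[ = 1%E.
Let P A : R := fine (mu A).

Let PE A : measurable A -> mu A = (P A)%:E.
Proof. by move=> mA; rewrite fineK// fin_num_measure. Qed.

Let P_ge0 A : 0 <= P A. Proof. exact/fine_ge0/measure_ge0. Qed.

Let P_le (A B : set R) : measurable A -> measurable B -> A `<=` B -> P A <= P B.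
Proof. by move=> mA mB AB; rewrite fine_le ?fin_num_measure// le_measure ?inE. Qed.

Let P_U (A B C : set R) : measurable A -> measurable B -> measurable C ->
  A `<=` B `|` C -> P A <= P B + P C.
Proof.
move=> mA mB mC ABC; rewrite -lee_fin EFinD -!PE//.
apply: le_trans (measureU2 _ mB mC).
by rewrite le_measure ?inE//; exact: measurableU.
Qed.

Lemma probability_itvNy_lt0 (x : R) : x < 0 -> mu `]-oo, x] = 0%E.
Proof.
move=> x0; apply/eqP; rewrite eq_le measure_ge0 andbT.
have <- : mu (~` `[0, 1[) = 0%E.
  by rewrite probability_setC//= mu01 subee.
rewrite le_measure ?inE//=; first exact: measurableC.
by move=> y /=; rewrite !in_itv/= => yx /andP[y0 _]; lra.
Qed.

Lemma probability_itvNy_ge1 (x : R) : 1 <= x -> mu `]-oo, x[ = 1%E.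
Proof.
move=> x1; apply/eqP; rewrite eq_le probability_le1//= -mu01 le_measure ?inE//=.
by move=> y /=; rewrite !in_itv/= => /andP[_ y1]; exact: lt_le_trans y1 x1.
Qed.

Lemma exists_quantile01 (q : R) : 0 < q -> q <= 1 ->
  exists s, (q%:E <= mu `]-oo, s])%E /\ (mu `]-oo, s[ <= q%:E)%E.
Proof.
move=> q0 q1; apply: (@exists_quantile _ mu (-1) 1).
  by rewrite probability_itvNy_lt0 ?lte_fin// ltrN10.
apply: (@le_trans _ _ 1%E); first by rewrite lee_fin.
rewrite -(@probability_itvNy_ge1 1)// le_measure ?inE//=.
by move=> y /=; rewrite !in_itv/= => /ltW.
Qed.

(** The median is the quantile whose order is the mass to the left of [u] plus half the mass of the
    interval. Both halves contain [s], which may be an atom. *)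
Lemma exists_median (u v : R) : (0 < mu `[u, v[)%E -> exists s,
  fine (mu `[u, v[) / 2 <= fine (mu (`[u, v[ `&` `]-oo, s])) /\
   fine (mu `[u, v[) / 2 <= fine (mu (`[u, v[ `&` `[s, +oo[)).
Proof.
move=> J0; set J : set R := (`[u, v[)%classic in J0 *.
have uv : u < v.
  rewrite ltNge; apply/negP => vu; move: J0; rewrite /J set_itv_ge ?measure0 ?ltxx//.
  by rewrite bnd_simp -leNgt.
have mJ : measurable J by exact: measurable_itv.
have PJ : 0 < P J by rewrite -lte_fin -PE.
have PuJ : P `]-oo, u[ + P J = P `]-oo, v[.
  rewrite /P -fineD ?fin_num_measure// -measureU//.
    congr (fine (mu _)); apply/seteqP; split => x /=; rewrite /J/= !in_itv/=.
      by case=> [xu|/andP[]//]; exact: lt_trans xu uv.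
    by move=> xv; rewrite xv andbT; case: (ltP x u) => h; [left|right].
  by apply/seteqP; split => x //= []; rewrite /J/= !in_itv/= => xu; rewrite leNgt xu.
have Pv1 : P `]-oo, v[ <= 1 by rewrite -lee_fin -PE// probability_le1.
have [||s [qs sq]] := @exists_quantile01 (P `]-oo, u[ + P J / 2).
- by have := P_ge0 `]-oo, u[; lra.
- by lra.
rewrite PE// lee_fin in qs; rewrite PE// lee_fin in sq.
exists s; rewrite -/(P _) -/(P _) -/(P _).
have us : u <= s.
  rewrite leNgt; apply/negP => su; have : P `]-oo, s] <= P `]-oo, u[.
    by apply: P_le => // x /=; rewrite !in_itv/= => xs; exact: le_lt_trans xs su.
  lra.
have sv : s < v.
  rewrite ltNge; apply/negP => vs; have : P `]-oo, v[ <= P `]-oo, s[.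
    by apply: P_le => // x /=; rewrite !in_itv/= => xv; exact: lt_le_trans xv vs.
  lra.
have hL : P `]-oo, s] <= P `]-oo, u[ + P (J `&` `]-oo, s]).
  apply: P_U => //; first exact: measurableI.
  move=> x /=; rewrite /J/= !in_itv/= => xs.
  by have [xu|xu] := ltP x u; [left|right; rewrite (le_lt_trans xs sv)].
have hR : P `]-oo, v[ <= P `]-oo, s[ + P (J `&` `[s, +oo[).
  apply: P_U => //; first exact: measurableI.
  move=> x /=; rewrite /J/= !in_itv/= => xv.
  by have [xs|xs] := ltP x s; [left|right; rewrite (le_trans us xs) xv].
by split; lra.
Qed.
End half_mass.

(** * Rectangles of pairs that satisfy the inequality *)

Lemma exists_third (M N : nat) : (6 * M.+1 <= N)%N ->
  exists n, [/\ (2 * n + n <= N)%N, (N <= 6 * n)%N & (M < n)%N].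
Proof. by move=> MN; exists (N %/ 3)%N; split; lia. Qed.

Lemma third_shift_bounds (M N n i j : nat) : (2 * n + n <= N)%N -> (M < n)%N ->
  (i < n)%N -> (j < n)%N ->
  [/\ (i <= 2 * n + j)%N, (M <= 2 * n + j - i)%N & (2 * n + j < N)%N].
Proof. by move=> *; split; lia. Qed.

Section hitting.
Context {R : realType}.
Variables (mu : probability R R) (T S : R -> R) (D : seq R).
Hypotheses (mT : measurable_fun [set: R] T) (mS : measurable_fun [set: R] S).
Hypotheses (TK : cancel T S) (SK : cancel S T).
Hypotheses (invT : invariant_measure T mu) (ergT : ergodic_measure T mu).
Hypothesis T01 : forall x : R, 0 <= x < 1 -> 0 <= T x < 1.
Hypothesis trT : forall u v : R, 0 <= u -> v <= 1 -> u < v ->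
  (forall d, d \in D -> u < d -> v <= d) ->
  exists c, forall x : R, u <= x < v -> T x = x + c.
Hypothesis mu01 : mu `[0, 1[ = 1%E.

Let muS (A : set R) i : measurable A -> mu (iter i S @^-1` A) = mu A.
Proof. exact/measure_iter_preimage/(invariant_inverse mS TK invT). Qed.

(** The levels are disjoint translates of [[u, v)] inside [0,1), so Lebesgue measure gives
    [N * (v - u) <= 1]. Bisecting the base [m] times divides its length by [2 ^+ m] and its mass by
    at most as much. *)
Lemma exists_dyadic_tower (m : nat) (a b : R) :
  0 <= a -> b <= 1 -> (0 < mu `[a, b[)%E ->
  exists u v N, [/\ a <= u, u < v, v <= b &
   [/\ forall i x, (i < N)%N -> u <= x < v ->
        iter i T x = x + (iter i T u - u),
      forall i j x y, (i < j < N)%N -> u <= x < v -> u <= y < v ->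
        iter i T x <> iter j T y,
      N%:R * (v - u) <= 2 ^- m &
      1 <= 2 ^+ ((size D).+2 + m) * (N%:R * fine (mu `[u, v[))]].
Proof.
move=> a0 b1 I0.
have [u [v [N [au uv vb [tr dis mass]]]]] :=
  exists_tower mT mS TK SK invT ergT T01 trT a0 b1 I0.
pose L i : set R := (`[u + (iter i T u - u), v + (iter i T u - u)[)%classic.
have len : N%:R * (v - u) <= 1.
  have Li i x : (i < N)%N -> L i x -> exists2 y, u <= y < v & x = iter i T y.
    move=> iN; rewrite /L/= in_itv/= => Lx.
    exists (x - (iter i T u - u)); first lra.
    by rewrite tr ?subrK//; lra.
  have mL i : measurable (L i) by exact: measurable_itv.
  have lebL : lebesgue_measure (\bigcup_(i < N) L i) = (N%:R * (v - u))%:E.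
    apply: etrans (measure_bigcup_ord lebesgue_measure mL _) _.
      move=> i j /= iN jN [x [/(Li _ _ iN)[y yuv ->] /(Li _ _ jN)[z zuv E]]].
      case: (ltngtP i j) => // ij; exfalso.
        by apply: (dis i j y z) => //; rewrite ij.
      by apply: (dis j i z y) => //; rewrite ij.
    rewrite (eq_bigr (fun=> (v - u)%:E)) => [|i _]; last first.
      rewrite [LHS]lebesgue_measure_itv/= lte_fin ltrD2r uv -EFinB.
      by congr (_%:E); lra.
    by rewrite sumEFin sumr_const card_ord mulr_natl.
  have leb1 : lebesgue_measure (`[0, 1[%classic : set R) = 1%E.
    by rewrite lebesgue_measure_itv/= lte_fin ltr01 -EFinB subr0.
  rewrite -lee_fin -lebL -leb1; apply: le_measure; rewrite ?inE//.
    by apply: bigcup_measurable => i _; exact: measurable_itv.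
  move=> x [i iN /(Li _ _ iN)[y /andP[uy yv] ->]]; rewrite /= in_itv/=.
  by apply: iter01 => //; rewrite (le_trans a0 (le_trans au uy)); lra.
pose nu A := fine (mu A).
have nuU (x w y : R) : x < w -> w < y -> nu `[x, y[ <= nu `[x, w[ + nu `[w, y[.
  move=> xw wy; rewrite /nu -fineD ?fin_num_measure// fine_le//.
  - by rewrite fin_num_measure.
  - by rewrite fin_numD !fin_num_measure.
  apply: le_trans (measureU2 _ _ _) => //; rewrite le_measure ?inE//.
    exact: measurableU.
  move=> z /=; rewrite !in_itv/= => /andP[xz zy].
  by case: (ltP z w) => zw; [left|right]; apply/andP.
have [u' [v' [uu' uv' vv' lenE mass']]] := exists_itv_dyadic nuU m uv.
have sub x : u' <= x < v' -> u <= x < v by move=> ?; lra.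
have tr' i x : (i < N)%N -> u' <= x < v' -> iter i T x = x + (iter i T u' - u').
  move=> iN /sub xuv; rewrite (tr _ _ iN xuv) (tr _ u' iN); first lra.
  by apply: sub; rewrite lexx.
exists u', v', N; split; [lra|by []|lra|split => //].
- by move=> i j x y ij /sub xuv /sub yuv; exact: dis.
- by rewrite lenE mulrA -[leRHS]mul1r ler_wpM2r// invr_ge0 exprn_ge0.
- apply: le_trans mass _; rewrite exprD -mulrA ler_wpM2l ?exprn_ge0//.
  by rewrite mulrCA ler_wpM2l.
Qed.

Hypothesis atomless : forall x : R, mu [set x] = 0%E.

(** Without atoms the quantile is attained exactly: []-oo, s]] and [[0, s[] differ by a null set. *)
Let small_itv (q : R) : 0 < q -> q < 1 ->
  exists s, s <= 1 /\ mu `[0, s[ = q%:E.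
Proof.
move=> q0 q1; have [s [qs sq]] := exists_quantile01 mu01 q0 (ltW q1).
exists s; split.
  rewrite leNgt; apply/negP => s1; move: sq.
  by rewrite (probability_itvNy_ge1 mu01 (ltW s1)) lee_fin leNgt q1.
apply/eqP; rewrite eq_le; apply/andP; split.
  apply: le_trans sq; rewrite le_measure ?inE// => x /=.
  by rewrite !in_itv/= => /andP[].
apply: le_trans qs _.
pose N : set R := ~` `[0, 1[.
have mN : measurable N by exact: measurableC.
have muN : mu N = 0%E by rewrite probability_setC//= mu01 subee.
pose Ns := N `|` [set s].
have mNs : measurable Ns by exact: measurableU.
have muNs : mu Ns = 0%E.
  apply/eqP; rewrite eq_le measure_ge0 andbT.
  have : (mu Ns <= mu N + mu [set s])%E.
    exact: measureU2 (measurable_set1 s).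
  by rewrite muN atomless adde0.
rewrite -[leRHS]add0e -muNs.
apply: le_trans (measureU2 _ mNs (measurable_itv _)).
rewrite le_measure ?inE//; first by apply: measurableU => //; exact: measurable_itv.
move=> x /=; rewrite !in_itv/= => xs.
have [x0|x0] := ltP x 0; first by left; left; rewrite /N/= in_itv/= => /andP[]; lra.
by move: xs; rewrite le_eqVlt => /predU1P[->|xs]; [left; right|right].
Qed.

(** The bound [c] is uniform in [M] because the tower keeps mass at least [2 ^- K] however high it
    is. *)
Lemma exists_hitting_rectangle (m : nat) : exists2 c : R, 0 < c &
  forall M : nat, exists A B : set R, [/\ measurable A, measurable B,
    (c%:E <= mu A * mu B)%E &
    forall x y, A x -> B y -> exists2 n, (M <= n)%N &
      0 <= n%:R * (iter n T x - y) <= 2 ^- m].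
Proof.
(* Each side of the rectangle uses at least a sixth of the levels and half of the base, hence the
   twelfth. *)
set K := ((size D).+2 + m)%N; set e : R := 2 ^- K / 12.
have e0 : 0 < e by rewrite /e divr_gt0// invr_gt0 exprn_gt0.
exists (e * e) => [|M]; first exact: mulr_gt0.
(* A base of mass at most [q] forces a tower of mass at least [2 ^- K] to have at least [6 * M.+1]
   levels. *)
pose q : R := 2 ^- K / (6 * M.+1%:R).
have M0 : 1 <= M.+1%:R :> R by rewrite ler1n.
have K1 : 2 ^- K <= 1 :> R by rewrite invf_le1 ?exprn_gt0// exprn_ege1// ler1n.
have K0 : 0 < 2 ^- K :> R by rewrite invr_gt0 exprn_gt0.
have q0 : 0 < q by rewrite /q divr_gt0//; lra.
have q1 : q < 1 by rewrite /q ltr_pdivrMr; lra.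
have [s [s1 Iq]] := small_itv q0 q1.
have I0 : (0 < mu `[0%R, s[)%E by rewrite Iq lte_fin.
have [u [v [N [u0 uv vs [tr dis len mass]]]]] := exists_dyadic_tower m (lexx 0) s1 I0.
rewrite -/K in mass.
set J : set R := (`[u, v[)%classic in mass.
have mJ : measurable J by exact: measurable_itv.
have {}mass : 2 ^- K <= N%:R * fine (mu J).
  by rewrite -div1r ler_pdivrMr ?exprn_gt0// mulrC.
have Jq : fine (mu J) <= q.
  rewrite -lee_fin fineK ?fin_num_measure// -Iq le_measure ?inE// => x.
  by rewrite /J/= !in_itv/=; lra.
have J0 : 0 < fine (mu J).
  rewrite ltNge; apply/negP => h.
  have : N%:R * fine (mu J) <= 0 by rewrite mulr_ge0_le0.
  lra.
have NM : (6 * M.+1 <= N)%N.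
  rewrite -(ler_nat R) natrM.
  have : 2 ^- K <= N%:R * q by apply: le_trans mass _; rewrite ler_wpM2l.
  rewrite /q mulrA ler_pdivlMr; last lra.
  by rewrite [leRHS]mulrC ler_pM2l.
have [w [hL hR]] : exists w, fine (mu J) / 2 <= fine (mu (J `&` `]-oo, w])) /\
   fine (mu J) / 2 <= fine (mu (J `&` `[w, +oo[)).
  apply: (exists_median mu01).
  by rewrite -[X in (_ < X)%E](fineK (fin_num_measure mu _ mJ)) lte_fin.
set Lf := J `&` `]-oo, w] in hL; set Rt := J `&` `[w, +oo[ in hR.
have mLf : measurable Lf by exact: measurableI.
have mRt : measurable Rt by exact: measurableI.
(* Levels below [n] serve for [x], levels from [2 * n] to [3 * n - 1] for [y]: their indices differ
   by more than [n], hence by more than [M]. *)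
have [n [n3 n6 Mn]] := exists_third NM.
have massn (X : set R) k : measurable X -> X `<=` J -> fine (mu J) / 2 <= fine (mu X) ->
    (k + n <= N)%N -> (e%:E <= mu (\bigcup_(i < n) (iter (k + i) S @^-1` X)))%E.
  move=> mX XJ hX kn; rewrite measure_bigcup_ord; last 2 first.
  - by move=> i; exact: measurable_iter_preimage.
  - move=> i j /= iN jN [z [/= /XJ + /XJ]]; rewrite /J/= !in_itv/= => zi zj.
    have E i' : iter (k + i') T (iter (k + i') S z) = z.
      by rewrite iter_cancel// subnn.
    have lvl i1 i2 : (i1 < i2)%N -> (i2 < n)%N -> (k + i1 < k + i2 < N)%N.
      move=> i12 i2n; rewrite ltn_add2l i12/=; apply: leq_trans kn.
      by rewrite ltn_add2l.
    case: (ltngtP i j) => // ij; exfalso.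
      exact: dis (lvl _ _ ij jN) zi zj (etrans (E i) (esym (E j))).
    exact: dis (lvl _ _ ij iN) zj zi (etrans (E j) (esym (E i))).
  rewrite (eq_bigr (fun=> (fine (mu X))%:E)) => [|i _]; last first.
    by rewrite fineK ?fin_num_measure//; exact: muS.
  rewrite sumEFin sumr_const card_ord -[_ *+ n]mulr_natl lee_fin /e.
  have nN : N%:R <= 6 * n%:R :> R by rewrite -natrM ler_nat.
  have : N%:R * fine (mu J) <= 6 * n%:R * (2 * fine (mu X)) by apply: ler_pM => //; lra.
  lra.
exists (\bigcup_(i < n) (iter (0 + i) S @^-1` Rt)).
exists (\bigcup_(i < n) (iter (2 * n + i) S @^-1` Lf)); split.
- by apply: bigcup_measurable => i _; exact: measurable_iter_preimage.
- by apply: bigcup_measurable => i _; exact: measurable_iter_preimage.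
- rewrite EFinM; apply: lee_pmul; rewrite ?lee_fin ?(ltW e0)//.
    apply: (massn Rt 0%N mRt (@subIsetl _ _ _) hR).
    by apply: leq_trans n3; exact: leq_addl.
  exact: (massn Lf (2 * n)%N mLf (@subIsetl _ _ _) hL n3).
- move=> x y [i /= ilt [xJ xw]] [j /= jlt [yJ yw]].
  have [ij Mij ijN] := third_shift_bounds n3 Mn ilt jlt.
  (* This time lifts [x] from level [i] to level [2 * n + j], that of [y]. There it lies to the
     right of [y], or at [y], and no further than the length of the base, which [len] bounds after
     multiplication by [N]. *)
  exists (2 * n + j - i)%N => //.
  move: xJ xw yJ yw; rewrite add0n /J/= !in_itv/= andbT.
  set x' := iter i S x; set y' := iter _ S y => xJ xw yJ yw.
  have yE : y = y' + (iter (2 * n + j) T u - u).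
    by rewrite -(tr _ _ ijN yJ) iter_cancel// subnn.
  have xE : iter (2 * n + j - i) T x = x' + (iter (2 * n + j) T u - u).
    rewrite -(tr _ _ ijN xJ) -[in RHS](subnK ij) iterD; congr (iter _ T _).
    by rewrite iter_cancel// subnn.
  have -> : iter (2 * n + j - i) T x - y = x' - y' by rewrite xE [X in _ - X]yE; lra.
  have yx : 0 <= x' - y' by lra.
  rewrite mulr_ge0//=; apply: le_trans len; apply: ler_pM => //; last lra.
  by rewrite ler_nat; apply: leq_trans (ltnW ijN); exact: leq_subr.
Qed.

End hitting.

(** * A criterion for a zero lower limit *)

Lemma limn_einf_eq0 (R : realType) (u : nat -> R) : (forall n, 0 <= u n) ->
  (forall m M : nat, exists2 n, (M <= n)%N & u n <= 2 ^- m) ->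
  limn_einf (fun n => (u n)%:E) = 0%E.
Proof.
move=> u0 usmall; rewrite limn_einf_lim.
suff -> : einfs (fun n => (u n)%:E) = cst 0%E by exact: lim_cst.
apply/funext => M; rewrite /einfs/=; apply/eqP; rewrite eq_le; apply/andP; split.
  apply/lee_addgt0Pr => e e0; rewrite add0e.
  have [m me] : exists m, 2 ^- m <= e.
    exists (Num.trunc e^-1).+1; rewrite invf_ple ?posrE ?exprn_gt0//.
    apply: le_trans (ltW (truncnS_gt _)) _.
    by rewrite -natrX ler_nat ltnW// ltn_expl.
  have [n Mn un] := usmall m M.
  apply: le_trans (_ : (u n)%:E <= _)%E; last by rewrite lee_fin (le_trans un).
  by apply: ereal_inf_lbound; exists n.
by apply: le_ereal_inf_tmp => _ [n _ <-]; rewrite lee_fin.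
Qed.

(** * Full measure of the limsup sets *)

Section right_approach.
Context {R : realType}.
Variables (mu : probability R R) (T S : R -> R) (D : seq R).
Hypotheses (mT : measurable_fun [set: R] T) (mS : measurable_fun [set: R] S).
Hypotheses (TK : cancel T S) (SK : cancel S T).
Hypotheses (invT : invariant_measure T mu) (ergT : ergodic_measure T mu).

Definition right_approach (m M : nat) : set (R * R) :=
  \bigcup_(n in [set n | (M <= n)%N])
    [set z | 0 <= n%:R * (iter n T z.1 - z.2) <= 2 ^- m].

Definition limsup_right_approach (m : nat) : set (R * R) :=
  \bigcap_M right_approach m M.

Lemma measurable_right_approach m M : measurable (right_approach m M).
Proof.
apply: bigcup_measurable => n _.
have mf : measurable_fun [set: R * R]
    (fun z : R * R => n%:R * (iter n T z.1 - z.2)).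
  apply: measurable_funM; first exact: measurable_cst.
  apply: measurable_funB; last exact: measurable_snd.
  exact: measurableT_comp (measurable_iter mT n) measurable_fst.
rewrite [X in measurable X](_ : _ =
    (fun z : R * R => n%:R * (iter n T z.1 - z.2)) @^-1` `[0, 2 ^- m]).
  by rewrite -[X in measurable X]setTI; apply: mf => //; exact: measurable_itv.
by apply/seteqP; split => z /=; rewrite in_itv.
Qed.

Lemma measurable_limsup_right_approach m : measurable (limsup_right_approach m).
Proof. by apply: bigcapT_measurable => M; exact: measurable_right_approach. Qed.

Lemma limsup_right_approach_ge m (c : \bar R) :
  (forall M, c <= (mu \x mu) (right_approach m M))%E ->
  (c <= (mu \x mu) (limsup_right_approach m))%E.
Proof.
move=> h; apply: nonincreasing_measure_ge h => [||M z [n /= Mn hn]].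
- apply: le_lt_trans (ltry 1).
  exact: (probability_le1 (mu \x mu)%E (measurable_right_approach m 0)).
- exact: measurable_right_approach.
- by exists n => //=; exact: ltnW.
Qed.

(** The points [iter i T p] are atoms of equal mass, so they cannot all be distinct and [p] is
    periodic. At multiples of the period the pair [(p, p)] gives the value 0. *)
Lemma limsup_right_approach_atom m (p : R) : (0 < mu [set p])%E ->
  (0 < (mu \x mu) (limsup_right_approach m))%E.
Proof.
move=> p0; have mp : measurable [set p] by exact: measurable_set1.
have muS i : mu (iter i S @^-1` [set p]) = mu [set p].
  exact: measure_iter_preimage mS (invariant_inverse mS TK invT) _ _ mp.
have [k k0 kp] : exists2 k, (0 < k)%N & iter k T p = p.
  apply: contrapT => nper.
  pose F i := iter i S @^-1` [set p].
  have mF i : measurable (F i) by exact: measurable_iter_preimage.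
  have FE i x : F i x -> x = iter i T p.
    by move=> /= <-; rewrite iter_cancel// subnn.
  have per i j : (i < j)%N -> iter i T p = iter j T p -> False.
    move=> ij E; apply: nper; exists (j - i)%N; first by rewrite subn_gt0.
    by rewrite -(iter_cancel p TK (ltnW ij)) -E iter_cancel// subnn.
  have dF n : trivIset `I_n F.
    move=> i j _ _ [x [/FE -> /FE E]]; case: (ltngtP i j) => // ij; exfalso.
      exact: per ij E.
    exact: per ij (esym E).
  set c := fine (mu [set p]).
  have c0 : 0 < c by rewrite fine_gt0// p0 ltey_eq fin_num_measure.
  pose n := (Num.trunc c^-1).+1.
  have : (mu (\bigcup_(i < n) F i) <= 1)%E.
    by apply: probability_le1; apply: bigcup_measurable => i _; exact: mF.
  rewrite [X in (X <= _)%E](_ : _ = (n%:R * c)%:E); last first.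
    apply: etrans (measure_bigcup_ord mu mF (dF n)) _.
    rewrite (eq_bigr (fun=> c%:E)) => [|i _].
      by rewrite sumEFin sumr_const card_ord mulr_natl.
    exact: etrans (muS i) (esym (fineK (fin_num_measure mu _ mp))).
  by rewrite lee_fin leNgt -ltr_pdivrMr// div1r truncnS_gt.
have kMp M : iter (k * M) T p = p.
  by elim: M => [|M IH]; [rewrite muln0|rewrite mulnS iterD IH].
apply: (@lt_le_trans _ _ ((mu \x mu)%E ([set p] `*` [set p]))).
  by rewrite product_measure1E// mule_gt0.
rewrite le_measure ?inE//.
- exact: measurableX.
- exact: measurable_limsup_right_approach.
move=> [x y] [/= -> ->] M _; exists (k * M)%N; first by rewrite /= leq_pmull.
by rewrite /= kMp subrr mulr0 lexx invr_ge0 exprn_ge0.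
Qed.

Hypothesis T01 : forall x : R, 0 <= x < 1 -> 0 <= T x < 1.
Hypothesis trT : forall u v : R, 0 <= u -> v <= 1 -> u < v ->
  (forall d, d \in D -> u < d -> v <= d) ->
  exists c, forall x : R, u <= x < v -> T x = x + c.
Hypothesis rtrT : forall y : R, exists2 e, 0 < e &
  forall z, y <= z < y + e -> T z - T y = z - y.
Hypothesis mu01 : mu `[0, 1[ = 1%E.

Lemma limsup_right_approach_gt0 m :
  (0 < (mu \x mu) (limsup_right_approach m))%E.
Proof.
have [[p p0]|atomless] := pselect (exists p, (0 < mu [set p])%E).
  exact: limsup_right_approach_atom p0.
have {}atomless (x : R) : mu [set x] = 0%E.
  apply/eqP; rewrite eq_le measure_ge0 andbT leNgt; apply/negP => x0.
  by apply: atomless; exists x.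
have [c c0 hc] := exists_hitting_rectangle mT mS TK SK invT ergT T01 trT mu01 atomless m.
apply: (@lt_le_trans _ _ c%:E); first by rewrite lte_fin.
apply: limsup_right_approach_ge => M; have [A [B [mA mB AB hit]]] := hc M.
apply: le_trans AB _; rewrite -product_measure1E// le_measure ?inE//.
- exact: measurableX.
- exact: measurable_right_approach.
by move=> [x y] [/= Ax By]; have [n Mn hn] := hit _ _ Ax By; exists n.
Qed.

Lemma limsup_right_approach_full m :
  (mu \x mu)%E (limsup_right_approach m) = 1%E.
Proof.
apply: (product_forward_invariant mT invT ergT).
- exact: measurable_limsup_right_approach.
(* Asking for a time at least [M.+1] excludes 0 and leaves its predecessor, at least [M], for the
   orbit of [T x]; the smaller factor only helps. *)
- move=> x y h M _; have [[//|n] /= Mn] := h M.+1 I.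
  rewrite -iterS iterSr; set d := _ - y => /andP[n0 nd].
  have d0 : 0 <= d by rewrite -(pmulr_rge0 _ (ltr0Sn R n)).
  exists n => //=; rewrite mulr_ge0//=; apply: le_trans nd.
  by rewrite ler_wpM2r// ler_nat.
- move=> x y h M _; have [e e0 ye] := rtrT y.
  (* A time larger than [e^-1] forces the distance [d] below [e], since their product is at most 1.
     Then [T] moves [y] and the orbit point by the same translation and [d] is unchanged. *)
  have [n' /=] := h (maxn M (Num.trunc e^-1).+1) I.
  rewrite geq_max => /andP[]; case: n' => // n Mn en.
  move=> /andP[n0 nd]; exists n.+1 => //.
  set d := _ - y in n0 nd.
  have d0 : 0 <= d by rewrite -(pmulr_rge0 _ (ltr0Sn R n)).
  have de : d < e.
    rewrite ltNge; apply/negP => ed.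
    have : e^-1 < n.+1%:R.
      by apply: lt_le_trans (truncnS_gt _) _; rewrite ler_nat.
    rewrite -div1r ltr_pdivrMr// => ne.
    have : n.+1%:R * e <= n.+1%:R * d by rewrite ler_wpM2l.
    have : 2 ^- m <= 1 :> R by rewrite invf_le1 ?exprn_gt0// exprn_ege1// ler1n.
    lra.
  have dT : T (iter n.+1 T x) - T y = d by apply: ye; rewrite /d in d0 de; lra.
  change (is_true (0 <= n.+1%:R * (iter n.+1 T (T x) - T y) <= 2 ^- m)).
  by rewrite -iterSr iterS dT n0.
- exact: limsup_right_approach_gt0.
Qed.

Lemma ae_limn_einf_eq0 : {ae (mu \x mu)%E, forall z : R * R,
  limn_einf (fun n : nat => (n%:R * `|iter n T z.1 - z.2|)%:E) = 0%E}.
Proof.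
have neg : (mu \x mu)%E.-negligible (\bigcup_m ~` limsup_right_approach m).
  apply: negligible_bigcup => m; apply/negligibleP.
    by apply: measurableC; exact: measurable_limsup_right_approach.
  have mL := measurable_limsup_right_approach m.
  apply: etrans (probability_setC (mu \x mu)%E mL) _.
  by rewrite [X in (1 - X)%E](limsup_right_approach_full m) subee.
apply: negligibleS neg => z /= zn; apply: contrapT => zall; apply: zn.
apply: limn_einf_eq0 => [n|m M]; first by rewrite mulr_ge0.
have zm : limsup_right_approach m z.
  by apply: contrapT => zm; apply: zall; exists m.
have [n /= Mn /andP[n0 nm]] := zm M I; exists n => //.
by rewrite -[n%:R]normr_nat -normrM ger0_norm.
Qed.

End right_approach.

Theorem theorem4p1 (R : realType) (r : nat) (pi : {perm 'I_r}) (l : 'I_r -> R)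
  (mu : probability R R) :
  iet_data l ->
  mu `[0, 1[ = 1%E ->
  invariant_measure (iet_map pi l) mu ->
  ergodic_measure (iet_map pi l) mu ->
  {ae (mu \x mu)%E, forall z : R * R,
     limn_einf (fun n : nat =>
       (n%:R * `|iter n (iet_map pi l) z.1 - z.2|)%:E) = 0%E}.
Proof.
move=> hl mu01 invT ergT.
(* The right ends of the exchanged intervals also account for the left ends, each of which is 0 or a
   right end. *)
apply: (@ae_limn_einf_eq0 _ mu _ (iet_inv pi l) [seq iet_rgt l k | k <- enum 'I_r]) => //.
- exact: measurable_iet_map.
- exact: measurable_iet_map _ (iet_data_inv pi hl).
- exact: iet_mapK.
- exact: iet_invK.
- by move=> x; exact: iet_map01.
- move=> u v u0 v1 uv h; apply: iet_map_translation => // k.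
  by apply: h; apply: map_f; rewrite mem_enum.
- by move=> y; exact: iet_map_right_translation.
Qed.
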